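(* Let $n,p\ge 1$, $\lambda\ge 0$, and let $\Sigma$ be an $n$-dimensional complete (without boundary) $\lambda$-submanifold properly immersed in the Gauss space $\mathbb G^{n+p}$. Let $k\in\{1,2,\dots,n+p-2\}$ and $r=\frac{\lambda+\sqrt{\lambda^2+4n}}{2}$. If $\Sigma\subset\overline{E^{k+1}(r)}\times\mathbb R^{n+p-k-1}$, then $\Sigma\subset S^k(r)\times\mathbb R^{n+p-k-1}$.
   Context: The Gauss space $\mathbb G^m$ is $\mathbb R^m$ with its Euclidean metric and the density $e^{-f}=(2\pi)^{-m/2}e^{-|X|^2/2}$, where $X$ is the position vector. For an $n$-dimensional submanifold $\Sigma$ of $\mathbb G^{n+p}$, $\mathbf H$ denotes the mean curvature vector (the trace of the second fundamental form, not divided by $n$), $X^\perp$ the component of $X$ normal to $\Sigma$, and $\mathbf H_f=\mathbf H+X^\perp$ the weighted mean curvature vector. $\Sigma$ is a $\lambda$-submanifold if $|\mathbf H_f|=\lambda$ on $\Sigma$ for a constant $\lambda\ge 0$. $\mathbb R^{n+p}$ is identified with the orthogonal product $\mathbb R^{k+1}\times\mathbb R^{n+p-k-1}$; $\overline{E^{k+1}(r)}=\{u\in\mathbb R^{k+1}:|u|\ge r\}$ is the complement of the open ball of radius $r$ centered at the origin and $S^k(r)=\{u\in\mathbb R^{k+1}:|u|=r\}$. *)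

(* Defs.v *)
From HB Require Import structures.
From mathcomp Require Import all_boot all_order all_algebra.
From mathcomp Require Import all_classical all_reals all_analysis.
Set Implicit Arguments.
Unset Strict Implicit.
Unset Printing Implicit Defensive.
Import Order.TTheory GRing.Theory Num.Theory.
Import numFieldNormedType.Exports.
Local Open Scope classical_set_scope.
Local Open Scope ring_scope.

(* The norm `|x| of 'rV[R]_m in the library is the sup norm, whence [enorm].
   Both norms induce the same topology, so that continuity, differentiability
   and compactness are the library's. *)
Definition dotv (R : realType) (m : nat) (x y : 'rV[R]_m) : R :=
  \sum_(i < m) x 0 i * y 0 i.

Definition enorm (R : realType) (m : nat) (x : 'rV[R]_m) : R :=
  Num.sqrt (dotv x x).

Definition basis_vec (R : realType) (n : nat) (i : 'I_n) : 'rV[R]_n :=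
  delta_mx 0 i.

Definition partial (R : realType) (n m : nat) (i : 'I_n)
    (f : 'rV[R]_n -> 'rV[R]_m) : 'rV[R]_n -> 'rV[R]_m :=
  fun u => 'D_(basis_vec R i) f u.

Fixpoint Ck_on (R : realType) (n m k : nat) (U : set 'rV[R]_n)
    (f : 'rV[R]_n -> 'rV[R]_m) : Prop :=
  (forall u, U u -> {for u, continuous f}) /\
  (if k is k'.+1 then
     (forall u, U u -> differentiable f u) /\
     (forall i : 'I_n, Ck_on k' U (partial i f))
   else True).

Definition smooth_on (R : realType) (n m : nat) (U : set 'rV[R]_n)
    (f : 'rV[R]_n -> 'rV[R]_m) : Prop :=
  forall k, Ck_on k U f.

(* A chart is the map [cmap] on [cdom]; [cinv] is its inverse on the image.
   The values of [cmap] off [cdom], and of [cinv] off [cimg], are junk. *)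
Record chart (R : realType) (n : nat) (M : topologicalType) := Chart {
  cdom : set M;
  cmap : M -> 'rV[R]_n;
  cinv : 'rV[R]_n -> M }.

Definition cimg (R : realType) (n : nat) (M : topologicalType)
    (c : chart R n M) : set 'rV[R]_n := cmap c @` cdom c.

Definition is_chart (R : realType) (n : nat) (M : topologicalType)
    (c : chart R n M) : Prop :=
  [/\ open (cdom c), open (cimg c),
      forall x, cdom c x -> cinv c (cmap c x) = x,
      forall x, cdom c x -> {for x, continuous (cmap c)} &
      forall u, cimg c u -> {for u, continuous (cinv c)}].

Definition smooth_atlas (R : realType) (n : nat) (M : topologicalType)
    (A : set (chart R n M)) : Prop :=
  [/\ forall c, A c -> is_chart c,
      forall x, exists2 c, A c & cdom c x &
      forall c c', A c -> A c' ->
        smooth_on (cmap c @` (cdom c `&` cdom c')) (cmap c' \o cinv c)].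

(* Charts onto open subsets of R^n: the manifold has no boundary. *)
Definition smooth_manifold (R : realType) (n : nat) (M : topologicalType)
    (A : set (chart R n M)) : Prop :=
  [/\ hausdorff_space M, @second_countable M & smooth_atlas A].

Definition immersion (R : realType) (n m : nat) (M : topologicalType)
    (A : set (chart R n M)) (X : M -> 'rV[R]_m) : Prop :=
  forall c, A c ->
    smooth_on (cimg c) (X \o cinv c) /\
    forall u, cimg c u -> injective ('d (X \o cinv c) u).

Definition proper_map (M N : topologicalType) (X : M -> N) : Prop :=
  continuous X /\ forall K : set N, compact K -> compact (X @^-1` K).

Definition C1_curve (R : realType) (n : nat) (M : topologicalType)
    (A : set (chart R n M)) (g : R -> M) : Prop :=
  continuous g /\
  forall c t, A c -> cdom c (g t) ->
    derivable (cmap c \o g) t 1 /\ {for t, continuous (derive1 (cmap c \o g))}.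

(* The metric induced by the immersion X gives the velocity g' the length of
   dX(g') = (X \o g)'. *)
Definition curve_length (R : realType) (m : nat) (M : topologicalType)
    (X : M -> 'rV[R]_m) (g : R -> M) : \bar R :=
  (\int[lebesgue_measure]_(t in `[0%R, 1%R]) (enorm (derive1 (X \o g) t))%:E)%E.

(* Only g on [0, 1] matters. Allowing piecewise C^1 curves would not change the
   infimum: reparametrized so as to stop at its corners and its endpoints, such
   a curve is C^1 and extends to R by constants. The distance between points of
   distinct components is +oo. *)
Definition riem_dist (R : realType) (n m : nat) (M : topologicalType)
    (A : set (chart R n M)) (X : M -> 'rV[R]_m) (x y : M) : \bar R :=
  ereal_inf [set curve_length X g | g in
    [set g : R -> M | [/\ C1_curve A g, g 0 = x & g 1 = y]]].

(* The induced distance induces the topology of M, in which limits are taken. *)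
Definition complete_submanifold (R : realType) (n m : nat)
    (M : topologicalType) (A : set (chart R n M)) (X : M -> 'rV[R]_m) : Prop :=
  forall s : nat -> M,
    (forall e : R, 0 < e -> exists N : nat, forall i j : nat,
       (N <= i)%N -> (N <= j)%N -> (riem_dist A X (s i) (s j) < e%:E)%E) ->
    exists x : M, s @ \oo --> x.

(* Below, f is a local parametrization X \o cinv c of the immersed submanifold;
   row i of the Jacobian matrix 'J f u is the i-th partial derivative of f at
   u, so that the rows span the tangent space. *)
Definition gram (R : realType) (n m : nat) (f : 'rV[R]_n -> 'rV[R]_m)
    (u : 'rV[R]_n) : 'M[R]_n :=
  'J f u *m ('J f u)^T.

(* v^T = v J^T (J J^T)^-1 J is the orthogonal projection on the row space
   of J, a matrix of rank n when f is an immersion. *)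
Definition tangent_part (R : realType) (n m : nat) (f : 'rV[R]_n -> 'rV[R]_m)
    (u : 'rV[R]_n) (v : 'rV[R]_m) : 'rV[R]_m :=
  v *m ('J f u)^T *m invmx (gram f u) *m 'J f u.

Definition normal_part (R : realType) (n m : nat) (f : 'rV[R]_n -> 'rV[R]_m)
    (u : 'rV[R]_n) (v : 'rV[R]_m) : 'rV[R]_m :=
  v - tangent_part f u v.

(* The value of the second fundamental form on the i-th and j-th coordinate
   fields: the normal component of their flat covariant derivative. *)
Definition second_form (R : realType) (n m : nat) (f : 'rV[R]_n -> 'rV[R]_m)
    (u : 'rV[R]_n) (i j : 'I_n) : 'rV[R]_m :=
  normal_part f u (partial i (partial j f) u).

Definition mean_curvature (R : realType) (n m : nat)
    (f : 'rV[R]_n -> 'rV[R]_m) (u : 'rV[R]_n) : 'rV[R]_m :=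
  \sum_(i < n) \sum_(j < n) invmx (gram f u) i j *: second_form f u i j.

(* The gradient of the weight exponent |X|^2/2 + const is the position vector,
   which at u is f u. *)
Definition weighted_mean_curvature (R : realType) (n m : nat)
    (f : 'rV[R]_n -> 'rV[R]_m) (u : 'rV[R]_n) : 'rV[R]_m :=
  mean_curvature f u + normal_part f u (f u).

(* The vector H_f at a point does not depend on the chart. *)
Definition lambda_submanifold (R : realType) (n m : nat) (M : topologicalType)
    (A : set (chart R n M)) (X : M -> 'rV[R]_m) (lambda : R) : Prop :=
  forall c x, A c -> cdom c x ->
    enorm (weighted_mean_curvature (X \o cinv c) (cmap c x)) = lambda.

(* The identification of R^m with R^d x R^(m - d). *)
Definition split_coords (R : realType) (d m : nat) (hdm : (d <= m)%N)
    (x : 'rV[R]_m) : 'rV[R]_d * 'rV[R]_(m - d) :=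
  let y := castmx (erefl 1%N, esym (subnKC hdm)) x in (lsubmx y, rsubmx y).

Definition exterior (R : realType) (k : nat) (r : R) : set 'rV[R]_k.+1 :=
  [set u | r <= enorm u].

Definition esphere (R : realType) (k : nat) (r : R) : set 'rV[R]_k.+1 :=
  [set u | enorm u = r].

Lemma leq_split (n p k : nat) : (1 <= k <= n + p - 2)%N -> (k.+1 <= n + p)%N.
Proof.
case/andP=> k1 kle; apply: (leq_ltn_trans kle).
rewrite ltn_subrL /=; case: (n + p)%N k1 kle => //.
by case: k.
Qed.

(* Main.v *)
(* Write L for the drift Laplacian of the weight and Y for the projection of X to
   R^(k+1). Since L X = H_f - X, one finds
     L |Y|^2 <= 2 (n + lambda |Y| - |Y|^2),
     L |X|^2 <= 2 (n + lambda |X| - |X|^2),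
   and r is the positive root of t^2 = lambda t + n. By the first inequality
   |Y|^2 - r^2 is a nonnegative supersolution, so by the strong maximum principle
   (Hopf's barrier) the contact set |Y| = r is open. Its complement is then closed
   and open in M; were it nonempty, |X|^2 would by properness have a minimum on
   it, at a point where |X| >= |Y| > r and hence L |X|^2 < 0, which is absurd. *)
Require Import Defs.
From HB Require Import structures.
From mathcomp Require Import all_boot all_order all_algebra.
From mathcomp Require Import all_classical all_reals all_analysis.
From mathcomp Require Import ring lra.
Set Implicit Arguments.
Unset Strict Implicit.
Unset Printing Implicit Defensive.
Import Order.TTheory GRing.Theory Num.Theory.
Import numFieldNormedType.Exports.
Local Open Scope classical_set_scope.
Local Open Scope ring_scope.

(** * Derivative tests at a local minimum, along lines *)

(** The first claim is Fermat's rule. For the second, if [l < 0] the difference quotients of [g1] at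
    0 are negative, so [g1] is negative just to the right of 0, and the mean value theorem gives
    some [s > 0] near 0 with [g s < g 0]. *)
Lemma local_min_derive (R : realType) (g g1 : R -> R) (l : R) :
  (\forall t \near (0:R), is_derive (t : R) (1:R) g (g1 t)) ->
  is_derive (0:R) (1:R) g1 l ->
  (\forall t \near (0:R), g 0 <= g t) -> g1 0 = 0 /\ 0 <= l.
Proof.
move=> dg dg1 gmin.
have [e /= e0 He] : exists2 e : R, 0 < e &
    forall t, `|t| < e -> is_derive (t : R) (1:R) g (g1 t) /\ g 0 <= g t.
  have /nbhs_ballP[e e0 He] : \forall t \near (0 : R),
    is_derive (t : R) (1:R) g (g1 t) /\ g 0 <= g t by near do split.
  by exists e => // t te; apply: He; rewrite -ball_normE /= sub0r normrN.
have itvP t : t \in `](- e), e[ -> `|t| < e by rewrite in_itv /= ltr_norml.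
have g10 : g1 0 = 0.
  have /(@derive_val _ _ _ _ _ _ _) <- : is_derive (0:R) (1:R) g (g1 0).
    by have [] := He 0; rewrite ?normr0.
  apply: (@derive_val _ _ _ _ _ _ _ (@derive1_at_min _ g (- e) e 0 _ _ _ _)).
  - by rewrite (@le_trans _ _ 0) ?oppr_le0 // ltW.
  - by move=> t /itvP /He[[]].
  - by rewrite in_itv /= oppr_lt0 e0.
  - by move=> t /itvP /He[].
split => //; rewrite leNgt; apply/negP => l0.
have [dv1 dl] := dg1.
have : \forall h \near 0^', h^-1 *: (g1 (h + 0) - g1 0) < 0.
  have : (fun h => h^-1 *: ((g1 \o shift 0) (h *: (1 : R)) - g1 0)) @ 0^' --> l.
    by rewrite -dl; exact: dv1.
  move=> /cvgrPdist_lt /(_ (- l)); rewrite oppr_gt0 => /(_ l0) H.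
  near=> h.
  have : `|l - h^-1 *: ((g1 \o shift 0) (h *: (1 : R)) - g1 0)| < - l by near: h.
  rewrite ltr_norml => /andP[+ _] /=.
  rewrite /shift /= [h *: 1]mulr1 => ?; lra.
move=> /nbhs_ballP[d /= d0 Hd].
pose s := Num.min d e / 2.
have m0 : 0 < Num.min d e by rewrite lt_min d0 e0.
have s0 : 0 < s by rewrite divr_gt0.
have sm : s < Num.min d e by rewrite /s ltr_pdivrMr // ltr_pMr ?ltr1n.
move: sm; rewrite lt_min => /andP[sd se].
have absb t : t \in `[0, s]%R -> `|t| < e.
  by rewrite in_itv /= => /andP[t0 ts]; rewrite ger0_norm // (le_lt_trans ts).
have [c cs] : exists2 c, c \in `]0, s[%R & g s - g 0 = g1 c * (s - 0).
  apply: MVT => //.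
    by move=> x xs; have [] := He x => //; apply: absb; apply: subset_itv_oo_cc.
  by apply: derivable_within_continuous => x /absb /He[[]].
have gs : g 0 <= g s by have [] := He s; rewrite ?gtr0_norm.
move=> E.
have cb : 0 < c < s by move: cs; rewrite in_itv.
case/andP: cb => c0 cs'.
have : c^-1 *: (g1 (c + 0) - g1 0) < 0.
  apply: Hd; last by rewrite /= gt_eqF.
  by rewrite -ball_normE /= sub0r normrN gtr0_norm // (lt_trans cs').
rewrite addr0 g10 subr0 /GRing.scale /= pmulr_rlt0 ?invr_gt0 // => gc.
have : g1 c * (s - 0) < 0 by rewrite subr0 pmulr_llt0.
by rewrite -E subr_lt0 ltNge gs.
Unshelve. all: by end_near. Qed.

Lemma is_derive_line (R : realType) (n m : nat) (f : 'rV[R]_n -> 'rV[R]_m)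
    (u c : 'rV[R]_n) (t : R) (a : 'I_m) :
  differentiable f (t *: c + u) ->
  is_derive (t : R) (1:R) (fun s => f (s *: c + u) 0 a) ('D_c f (t *: c + u) 0 a).
Proof.
move=> df.
have dfc : derivable f (t *: c + u) c by exact: diff_derivable.
have -> : 'D_c f (t *: c + u) 0 a = 'D_c (fun v => f v 0 a) (t *: c + u).
  by rewrite (derive_mx dfc) mxE.
have {}dfc : derivable (fun v => f v 0 a) (t *: c + u) c.
  by move: dfc => /derivable_mxP; exact.
(* The difference quotient along the line is that of the directional derivative. *)
have E : (fun h : R => h^-1 *: (((fun s => f (s *: c + u) 0 a) \o shift t) (h *: (1 : R))
      - f (t *: c + u) 0 a)) =
    (fun h => h^-1 *: (((fun v => f v 0 a) \o shift (t *: c + u)) (h *: c)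
      - f (t *: c + u) 0 a)).
  by apply/funext => h /=; rewrite [h *: 1]mulr1 scalerDl addrA.
apply: DeriveDef; rewrite /derivable /derive /= E //.
Qed.

Lemma derive_partial (R : realType) (n m : nat) (f : 'rV[R]_n -> 'rV[R]_m)
    (u c : 'rV[R]_n) : differentiable f u ->
  'D_c f u = \sum_i c 0 i *: partial i f u.
Proof.
move=> df; rewrite deriveE // [in LHS](row_sum_delta c) linear_sum /=.
by apply: eq_bigr => i _; rewrite linearZ /= /partial deriveE.
Qed.

Lemma is_derive_sum_fct (R : realType) (m : nat) (f : 'I_m -> R -> R)
  (df : 'I_m -> R) (t : R) :
  (forall a, is_derive (t : R) (1:R) (f a) (df a)) ->
  is_derive (t : R) (1:R) (fun s => \sum_a f a s) (\sum_a df a).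
Proof.
move=> H; have -> : (fun s => \sum_a f a s) = \sum_a f a.
  by apply/funext => s; rewrite fct_sumE.
exact: is_derive_sum.
Qed.

Lemma is_derive_gauss (R : realType) (al a b c t : R) :
  is_derive (t : R) (1 : R) (fun s => expR (- al * (a * s ^+ 2 + 2 * b * s + c)))
    (- (al * (2 * a * t + 2 * b)) * expR (- al * (a * t ^+ 2 + 2 * b * t + c))).
Proof.
have dq : is_derive (t : R) (1 : R)
    (fun s => - al * (a * s ^+ 2 + 2 * b * s + c)) (- (al * (2 * a * t + 2 * b))).
  have -> : (fun s : R => - al * (a * s ^+ 2 + 2 * b * s + c)) =
      (- al) \*: (a \*: (id ^+ 2) + (2 * b) \*: id + cst c).
    by apply/funext => s.
  apply: is_derive_eq; rewrite /GRing.scale /=; ring.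
by rewrite [X in is_derive _ _ _ X]mulrC; apply: (@is_derive1_comp _ expR _ t _ _ _ dq).
Qed.

Lemma is_derive_sqr_scale (R : realType) (d : R) (x : R -> R) (t dx : R) :
  is_derive (t : R) (1 : R) x dx ->
  is_derive (t : R) (1 : R) (fun s => d * x s ^+ 2) (d * (2 * x t * dx)).
Proof.
move=> dxt.
have -> : (fun s : R => d * x s ^+ 2) = d \*: (x ^+ 2) by apply/funext.
by apply: is_derive_eq; rewrite /GRing.scale /= expr1.
Qed.

Lemma is_derive_mul_scale (R : realType) (d : R) (x x1 : R -> R) (t dx dx1 : R) :
  is_derive (t : R) (1 : R) x dx -> is_derive (t : R) (1 : R) x1 dx1 ->
  is_derive (t : R) (1 : R) (fun s => d * (2 * x s * x1 s))
    (d * (2 * dx * x1 t + 2 * x t * dx1)).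
Proof.
move=> dxt dx1t.
have -> : (fun s : R => d * (2 * x s * x1 s)) = (d * 2) \*: (x * x1).
  by apply/funext => s /=; rewrite /GRing.scale /= !mulrA.
by apply: is_derive_eq; rewrite /GRing.scale /=; ring.
Qed.

Lemma dotv_line (R : realType) (n : nat) (c p : 'rV[R]_n) (t : R) :
  dotv (t *: c + p) (t *: c + p) =
  dotv c c * t ^+ 2 + 2 * dotv c p * t + dotv p p.
Proof.
rewrite /dotv mulr_sumr !mulr_suml -!big_split /=.
by apply: eq_bigr => i _; rewrite !mxE; ring.
Qed.

Lemma cvg_line (R : realType) (n : nat) (c u : 'rV[R]_n) :
  t *: c + u @[t --> (0 : R)] --> u.
Proof.
suff : t *: c + u @[t --> (0 : R)] --> 0 *: c + u by rewrite scale0r add0r.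
apply: cvgD; last exact: cvg_cst.
exact: cvgZr_tmp.
Qed.

(** A weighted square norm of [F] minus a multiple of Hopf's barrier centred at [y]. Weights 0 and 1
    select |Y|^2 or |X|^2; [eps = 0] removes the barrier. *)
Definition penalized (R : realType) (n m : nat) (F : 'rV[R]_n -> 'rV[R]_m)
    (d : 'I_m -> R) (eps al : R) (y v : 'rV[R]_n) : R :=
  \sum_a d a * F v 0 a ^+ 2 - eps * expR (- al * dotv (v - y) (v - y)).

(** [local_min_derive] on the line through [u] in direction [c], where the exponent of the barrier
    is a quadratic polynomial in the parameter. *)
Lemma penalized_min (R : realType) (n m : nat) (F : 'rV[R]_n -> 'rV[R]_m)
    (U : set 'rV[R]_n) (d : 'I_m -> R) (eps al : R) (y u c : 'rV[R]_n) :
  open U -> Ck_on 2 U F -> U u ->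
  (\forall v \near u, penalized F d eps al y u <= penalized F d eps al y v) ->
  let p := u - y in let E := expR (- al * dotv p p) in
  (\sum_a d a * (2 * F u 0 a * ('D_c F u) 0 a) + 2 * eps * al * E * dotv c p = 0)
  /\
  0 <= \sum_a d a * (2 * ('D_c F u) 0 a ^+ 2
          + 2 * F u 0 a * (\sum_i \sum_j
              (c 0 i * c 0 j) *: partial j (partial i F) u) 0 a)
     + eps * E * (2 * al * dotv c c - 4 * al ^+ 2 * dotv c p ^+ 2).
Proof.
move=> Uo [_ [dF dF1]] Uu umin p E.
have lineU : \forall t \near (0 : R), U (t *: c + u).
  by apply: (@cvg_line _ _ c u U); apply: open_nbhs_nbhs.
have minl : \forall t \near (0 : R),
    penalized F d eps al y u <= penalized F d eps al y (t *: c + u).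
  exact: (@cvg_line _ _ c u _ umin).
(* The derivative along [c], written with the partial derivatives because it is their
   differentiability that [Ck_on 2] supplies. *)
pose F1 v := \sum_i c 0 i *: partial i F v.
have dF1u : differentiable F1 u.
  have -> : F1 = \sum_i (c 0 i \*: partial i F).
    by apply/funext => v; rewrite /F1 fct_sumE.
  apply: differentiable_sum => i; apply: differentiableZ.
  by have [_ [+ _]] := dF1 i; apply.
have D2 : 'D_c F1 u = \sum_i \sum_j (c 0 i * c 0 j) *: partial j (partial i F) u.
  have -> : F1 = \sum_i (c 0 i \*: partial i F).
    by apply/funext => v; rewrite /F1 fct_sumE.
  have df i : differentiable (partial i F) u by have [_ [+ _]] := dF1 i; apply.
  rewrite derive_sum; last by move=> i; apply: derivableZ; exact: diff_derivable.
  apply: eq_bigr => i _; rewrite deriveZ; last exact: diff_derivable.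
  rewrite derive_partial // scaler_sumr.
  by apply: eq_bigr => j _; rewrite scalerA.
pose cc := dotv c c; pose cp := dotv c p; pose pp := dotv p p.
pose G t := expR (- al * (cc * t ^+ 2 + 2 * cp * t + pp)).
pose g t := \sum_a d a * F (t *: c + u) 0 a ^+ 2 - eps * G t.
pose g1 t := \sum_a d a * (2 * F (t *: c + u) 0 a * F1 (t *: c + u) 0 a)
             + eps * al * ((2 * cc * t + 2 * cp) * G t).
have gE t : penalized F d eps al y (t *: c + u) = g t.
  by rewrite /penalized /g -addrA -/p dotv_line.
have dG t : is_derive (t : R) (1 : R) G (- (al * (2 * cc * t + 2 * cp)) * G t).
  exact: is_derive_gauss.
have G0 : G 0 = E by rewrite /G expr0n /= !mulr0 !add0r.
have dg : \forall t \near 0, is_derive (t : R) (1 : R) g (g1 t).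
  near=> t.
  have Ut : U (t *: c + u) by near: t.
  have d1 : is_derive (t : R) (1 : R) (fun s => \sum_a d a * F (s *: c + u) 0 a ^+ 2)
      (\sum_a d a * (2 * F (t *: c + u) 0 a * F1 (t *: c + u) 0 a)).
    apply: is_derive_sum_fct => a; apply: is_derive_sqr_scale.
    rewrite /F1 -derive_partial; last exact: dF.
    by apply: is_derive_line; exact: dF.
  have -> : g = (fun s => \sum_a d a * F (s *: c + u) 0 a ^+ 2) - eps \*: G.
    by apply/funext => s.
  by apply: is_derive_eq; rewrite /g1 /GRing.scale /=; ring.
pose l := \sum_a d a * (2 * ('D_c F u) 0 a ^+ 2
          + 2 * F u 0 a * (\sum_i \sum_j
              (c 0 i * c 0 j) *: partial j (partial i F) u) 0 a)
     + eps * E * (2 * al * dotv c c - 4 * al ^+ 2 * dotv c p ^+ 2).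
have dg1 : is_derive (0 : R) (1 : R) g1 l.
  have e0 : 0 *: c + u = u by rewrite scale0r add0r.
  have -> : g1 = (fun t => \sum_a d a * (2 * F (t *: c + u) 0 a * F1 (t *: c + u) 0 a))
     + (eps * al) \*: (((2 * cc) \*: id + cst (2 * cp)) * G).
    by apply/funext => s.
  have d1 : is_derive (0 : R) (1 : R)
      (fun t => \sum_a d a * (2 * F (t *: c + u) 0 a * F1 (t *: c + u) 0 a))
     (\sum_a d a * (2 * ('D_c F u) 0 a ^+ 2
          + 2 * F u 0 a * (\sum_i \sum_j
              (c 0 i * c 0 j) *: partial j (partial i F) u) 0 a)).
    apply: is_derive_sum_fct => a.
    have h1 : is_derive (0 : R) (1 : R) (fun s => F (s *: c + u) 0 a) ('D_c F u 0 a).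
      rewrite -{2}e0; apply: is_derive_line; rewrite e0; exact: dF.
    have h2 : is_derive (0 : R) (1 : R) (fun s => F1 (s *: c + u) 0 a) ('D_c F1 u 0 a).
      rewrite -{2}e0; apply: is_derive_line; rewrite e0; exact: dF1u.
    have := is_derive_mul_scale (d a) h1 h2.
    rewrite /= e0 D2 /F1 -(derive_partial c (dF u Uu)) => h.
    apply: (is_derive_eq h); ring.
  have e2 : ((2 * cc) \*: id + cst (2 * cp)) (0 : R) = 2 * cc * 0 + 2 * cp by [].
  apply: is_derive_eq; rewrite /l; congr (_ + _).
  rewrite e2 G0 /GRing.scale /= /cc /cp; ring.
have [|g10 l0] := local_min_derive dg dg1.
  by near=> t; rewrite -!gE scale0r add0r; near: t.
split => //; rewrite -[RHS]g10 /g1 /F1 scale0r add0r -derive_partial; last exact: dF.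
rewrite G0 /cp; ring.
Unshelve. all: by end_near. Qed.

(** * The Euclidean inner product *)

Lemma dotvE (R : realType) (n : nat) (x y : 'rV[R]_n) :
  dotv x y = (x *m y^T) 0 0.
Proof. by rewrite mxE; apply: eq_bigr => i _; rewrite mxE. Qed.

Lemma dotv_ge0 (R : realType) (n : nat) (x : 'rV[R]_n) : 0 <= dotv x x.
Proof. by apply: sumr_ge0 => i _; rewrite -expr2 sqr_ge0. Qed.

Lemma dotv_eq0 (R : realType) (n : nat) (x : 'rV[R]_n) :
  (dotv x x == 0) = (x == 0).
Proof.
apply/eqP/eqP => [x0|->]; last by apply: big1 => i _; rewrite mxE mul0r.
apply/rowP => i; rewrite mxE; apply/eqP; rewrite -sqrf_eq0 expr2; apply/eqP.
move: x0 => /eqP; rewrite psumr_eq0; last by move=> j _; rewrite -expr2 sqr_ge0.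
by move=> /allP /(_ i); rewrite mem_index_enum => /(_ isT) /eqP.
Qed.

Lemma sqr_enorm (R : realType) (n : nat) (x : 'rV[R]_n) :
  enorm x ^+ 2 = dotv x x.
Proof. by rewrite sqr_sqrtr // dotv_ge0. Qed.

(** Cauchy-Schwarz: with [a = |x|] and [b = |y|], expand the square of [b x - a y], then divide by
    [2 a b]. *)
Lemma dotv_le (R : realType) (n : nat) (x y : 'rV[R]_n) :
  dotv x y <= enorm x * enorm y.
Proof.
have pos (z : 'rV[R]_n) : 0 <= enorm z by exact: sqrtr_ge0.
have z0 (z : 'rV[R]_n) : enorm z = 0 -> z = 0.
  by move=> e; apply/eqP; rewrite -dotv_eq0 -sqr_enorm e expr0n.
have [/z0 -> | x0] := eqVneq (enorm x) 0.
  rewrite /dotv big1; last by move=> i _; rewrite mxE mul0r.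
  exact: mulr_ge0.
have [/z0 -> | y0] := eqVneq (enorm y) 0.
  rewrite /dotv big1; last by move=> i _; rewrite mxE mulr0.
  exact: mulr_ge0.
set a := enorm x in x0 *; set b := enorm y in y0 *.
have ab0 : 0 < a * b by rewrite mulr_gt0 // lt_def ?x0 ?y0 pos.
have : 0 <= dotv (b *: x - a *: y) (b *: x - a *: y) := dotv_ge0 _.
have -> : dotv (b *: x - a *: y) (b *: x - a *: y) =
    2 * (a * b) * (a * b - dotv x y).
  have -> : 2 * (a * b) * (a * b - dotv x y) =
     b ^+ 2 * a ^+ 2 + a ^+ 2 * b ^+ 2 - 2 * (a * b) * dotv x y by ring.
  rewrite [in X in _ * X + _ - _]sqr_enorm [in X in _ + _ * X - _]sqr_enorm.
  rewrite /dotv !mulr_sumr -!big_split -sumrB /=.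
  by apply: eq_bigr => i _; rewrite !mxE; ring.
have ab2 : 0 < 2 * (a * b) by exact: mulr_gt0.
by rewrite pmulr_rge0 // subr_ge0.
Qed.

(** * The induced metric and the drift Laplacian in a local parametrization *)

Section Gram.
Context (R : realType) (n m : nat) (F : 'rV[R]_n -> 'rV[R]_m) (u : 'rV[R]_n).
Hypothesis injF : injective ('d F u).
Local Notation J := ('J F u).
Local Notation Gi := (invmx (gram F u)).

Lemma mul_jacobian_eq0 (x : 'rV[R]_n) : x *m J = 0 -> x = 0.
Proof. by rewrite /jacobian mul_rV_lin1 -(linear0 ('d F u)) => /injF. Qed.

(** If [x] is in the kernel of the Gram matrix then |x J|^2 = 0, and [J] is injective on row
    vectors. *)
Lemma gram_unit : gram F u \in unitmx.
Proof.
rewrite -row_free_unit -kermx_eq0; apply/eqP/row_matrixP => i.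
rewrite row0; set x := row i _.
have xG : x *m gram F u = 0 by rewrite /x -row_mul mulmx_ker row0.
apply: mul_jacobian_eq0; apply/eqP; rewrite -dotv_eq0 dotvE.
by rewrite trmx_mul -mulmxA [J *m _]mulmxA mulmxA -/(gram F u) xG mul0mx mxE.
Qed.

Lemma trmx_gram_inv : Gi^T = Gi.
Proof. by rewrite trmx_inv /gram trmx_mul trmxK. Qed.

Lemma gram_inv_mulK : Gi *m J *m J^T *m Gi = Gi.
Proof. by rewrite -(mulmxA Gi) mulVmx ?mul1mx ?gram_unit. Qed.

(** The quadratic form is |p G^-1 J|^2, with G the Gram matrix. At a touching point it is the term
    of [barrier_form] that grows with [al]. *)
Lemma gram_inv_gt0 (p : 'rV[R]_n) : p != 0 -> 0 < (p *m Gi *m p^T) 0 0.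
Proof.
move=> p0.
have -> : (p *m Gi *m p^T) 0 0 = dotv (p *m Gi *m J) (p *m Gi *m J).
  by rewrite dotvE !trmx_mul trmx_gram_inv -[in LHS]gram_inv_mulK !mulmxA.
rewrite lt_def dotv_ge0 dotv_eq0 andbT; apply: contraNneq p0 => /mul_jacobian_eq0.
by move=> /(congr1 (mulmx^~ (gram F u))); rewrite mulmxKV ?gram_unit // mul0mx => ->.
Qed.

(** The second-order part of L applied to [F], before any projection to the normal space. *)
Definition raw_laplacian : 'rV[R]_m :=
  \sum_i \sum_j Gi i j *: partial i (partial j F) u.

(* L h = g^ij D_i D_j h + <drift, grad h> is the drift Laplacian in coordinates;
   this is the choice of the first-order term for which L F = H_f - F. *)
Definition drift : 'rV[R]_n := - (raw_laplacian + F u) *m J^T *m Gi.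

(* Up to the positive factor 2 al exp(- al |u - y|^2), this is L applied to the
   barrier v |-> exp(- al |v - y|^2). *)
Definition barrier_form (al : R) (y : 'rV[R]_n) : R :=
  2 * al * ((u - y) *m Gi *m (u - y)^T) 0 0 - \tr Gi - dotv drift (u - y).

(** The identity L X = H_f - X: the drift term removes the tangential parts of both [raw_laplacian]
    and [F u]. *)
Lemma raw_laplacian_drift :
  raw_laplacian + drift *m J = weighted_mean_curvature F u - F u.
Proof.
have meanE : mean_curvature F u = raw_laplacian - raw_laplacian *m J^T *m Gi *m J.
  rewrite /mean_curvature /raw_laplacian !mulmx_suml -sumrB; apply: eq_bigr => i _.
  rewrite !mulmx_suml -sumrB; apply: eq_bigr => j _.
  by rewrite /second_form /normal_part /tangent_part scalerBr !scalemxAl.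
rewrite /weighted_mean_curvature meanE /normal_part /tangent_part /drift.
rewrite !mulNmx !mulmxDl; apply/rowP => i; rewrite !mxE; ring.
Qed.

(* The rows are vectors c_a with g^-1 = sum_a c_a^T c_a, so that the second order
   part of L is the sum of the second derivatives along them. *)
Definition frame : 'M[R]_(m, n) := J^T *m Gi.

Lemma sum_frame (i j : 'I_n) : \sum_a frame a i * frame a j = Gi i j.
Proof.
have <- : frame^T *m frame = Gi.
  by rewrite /frame trmx_mul trmxK trmx_gram_inv mulmxA gram_inv_mulK.
by rewrite mxE; apply: eq_bigr => a _; rewrite [frame^T _ _]mxE.
Qed.

Lemma row_frameE (a : 'I_m) (i : 'I_n) : row a frame 0 i = frame a i.
Proof. exact: mxE. Qed.

Lemma sum_frame_sqr : \sum_a dotv (row a frame) (row a frame) = \tr Gi.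
Proof.
rewrite /dotv exchange_big /=; apply: eq_bigr => i _; rewrite -sum_frame.
by apply: eq_bigr => a _; rewrite !row_frameE.
Qed.

Lemma sum_frame_dot_sqr (p : 'rV[R]_n) :
  \sum_a dotv (row a frame) p ^+ 2 = (p *m Gi *m p^T) 0 0.
Proof.
have -> : p *m Gi *m p^T = p *m frame^T *m (p *m frame^T)^T.
  rewrite /frame !trmx_mul !trmxK trmx_gram_inv -[in LHS]gram_inv_mulK.
  by rewrite !mulmxA.
rewrite -dotvE; apply: eq_bigr => a _; rewrite expr2 mxE.
by congr (_ * _); apply: eq_bigr => i _; rewrite row_frameE [frame^T _ _]mxE mulrC.
Qed.

(** The matrix [frame *m J] is the orthogonal projection P on the tangent space, and the derivative
    of [F] along row [a] of [frame] is row [a] of P. Since P^T P = P, the squares in column [b] sum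
    to the diagonal entry. *)
Lemma sum_frame_derive_sqr (b : 'I_m) : differentiable F u ->
  \sum_a ('D_(row a frame) F u) 0 b ^+ 2 = (frame *m J) b b.
Proof.
move=> dF.
have PP : (frame *m J)^T *m (frame *m J) = frame *m J.
  rewrite /frame !trmx_mul !trmxK trmx_gram_inv !mulmxA; congr (_ *m _).
  by rewrite -!mulmxA; congr (_ *m _); rewrite !mulmxA gram_inv_mulK.
rewrite -[in RHS]PP mxE; apply: eq_bigr => a _.
by rewrite deriveEjacobian // -row_mul expr2 [_^T _ _]mxE [row _ _ _ _]mxE.
Qed.

Lemma trace_projection : \tr (frame *m J) = n%:R.
Proof. by rewrite mxtrace_mulC /frame mulmxA mulmxV ?gram_unit // mxtrace1. Qed.

Lemma sum_frame_hessian :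
  \sum_a \sum_i \sum_j (row a frame 0 i * row a frame 0 j) *:
      partial j (partial i F) u = raw_laplacian.
Proof.
(* Exchanging the sums on the right makes both sides differentiate in the same order; the
   coefficient is symmetric in [i] and [j]. *)
rewrite exchange_big /= [RHS]exchange_big /=; apply: eq_bigr => i _.
rewrite exchange_big /=; apply: eq_bigr => j _ /=.
rewrite -scaler_suml -sum_frame; congr (_ *: _).
by apply: eq_bigr => a _; rewrite !row_frameE mulrC.
Qed.

(** The projection on a coordinate subspace, kept inside the ambient space so that Y and X (for
    [predT]) are treated alike. *)
Definition masked (d : pred 'I_m) (x : 'rV[R]_m) : 'rV[R]_m :=
  \row_a ((d a)%:R * x 0 a).

Lemma dotv_mask (d : pred 'I_m) (x y : 'rV[R]_m) :
  dotv (masked d x) (masked d y) = dotv (masked d x) y.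
Proof.
apply: eq_bigr => a _; rewrite !mxE; case: (d a); rewrite ?mul1r ?mul0r //.
Qed.

(** At a local minimum, L of the penalized function is nonnegative. Hence half of L applied to [eps]
    times the barrier is at most half of L |Y|^2, which is at most n + |H_f| |Y| - |Y|^2. *)
Lemma penalized_min_le (U : set 'rV[R]_n) (d : pred 'I_m) (eps al : R)
    (y : 'rV[R]_n) :
  open U -> Ck_on 2 U F -> U u ->
  (\forall v \near u, penalized F (fun a => (d a)%:R) eps al y u <=
                      penalized F (fun a => (d a)%:R) eps al y v) ->
  eps * al * expR (- al * dotv (u - y) (u - y)) * barrier_form al y <=
  n%:R + enorm (weighted_mean_curvature F u) * enorm (masked d (F u))
    - enorm (masked d (F u)) ^+ 2.
Proof.
move=> Uo CF Uu umin.
have dF : differentiable F u by case: CF => _ [+ _]; apply.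
set p := u - y; set E := expR _.
pose D := fun a => (d a)%:R : R.
(* The first-order part of L comes from the gradient condition in the direction [drift], the
   second-order part from the Hessian condition summed over the rows of [frame]. *)
have [grad0 _] := penalized_min drift Uo CF Uu umin.
have hess c := (penalized_min c Uo CF Uu umin).2.
have : 0 <= \sum_a (\sum_b D b * (2 * ('D_(row a frame) F u) 0 b ^+ 2
          + 2 * F u 0 b * (\sum_i \sum_j
              (row a frame 0 i * row a frame 0 j) *: partial j (partial i F) u) 0 b)
     + eps * E * (2 * al * dotv (row a frame) (row a frame)
                  - 4 * al ^+ 2 * dotv (row a frame) p ^+ 2)).
  by apply: sumr_ge0 => a _; exact: hess.
rewrite big_split /= -mulr_sumr sumrB -!mulr_sumr sum_frame_sqr sum_frame_dot_sqr.
rewrite exchange_big /=.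
under eq_bigr => b _.
  rewrite -mulr_sumr big_split /= -!mulr_sumr sum_frame_derive_sqr //.
  rewrite -summxE sum_frame_hessian.
  over.
rewrite -/p -/E deriveEjacobian // in grad0.
(* The diagonal entries of the projection are sums of squares, so a partial trace is at most the
   full trace [n]. *)
have trle : \sum_b D b * (frame *m J) b b <= n%:R.
  rewrite -trace_projection; apply: ler_sum => b _.
  rewrite -sum_frame_derive_sqr // /D; case: (d b); rewrite ?mul1r ?mul0r //.
  by apply: sumr_ge0 => a _; exact: sqr_ge0.
have Hle := dotv_le (masked d (F u)) (weighted_mean_curvature F u).
(* By L X = H_f - X, the product <Y, H_f> is <Y, L X> + |Y|^2; Cauchy-Schwarz bounds it by |Y|
   |H_f|. *)
have HE : dotv (masked d (F u)) (weighted_mean_curvature F u) =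
    \sum_b D b * (F u 0 b * raw_laplacian 0 b) +
    \sum_b D b * (F u 0 b * (drift *m J) 0 b) +
    enorm (masked d (F u)) ^+ 2.
  rewrite sqr_enorm dotv_mask -!big_split; apply: eq_bigr => b _.
  have -> : weighted_mean_curvature F u = raw_laplacian + drift *m J + F u.
    by rewrite raw_laplacian_drift subrK.
  rewrite /D !mxE /=; ring.
rewrite HE in Hle.
move: grad0.
have -> : \sum_a (d a)%:R * (2 * F u 0 a * (drift *m J) 0 a) =
   2 * \sum_b D b * (F u 0 b * (drift *m J) 0 b).
  by rewrite mulr_sumr; apply: eq_bigr => b _; rewrite /D; ring.
have -> : \sum_b D b * (2 * (frame *m J) b b + 2 * F u 0 b * raw_laplacian 0 b) =
   2 * \sum_b D b * (frame *m J) b b + 2 * \sum_b D b * (F u 0 b * raw_laplacian 0 b).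
  by rewrite !mulr_sumr -big_split; apply: eq_bigr => b _ /=; ring.
rewrite /barrier_form -/p => grad0 hess0.
move: grad0 hess0 trle Hle.
set q := (p *m _ *m _) 0 0; set bp := dotv drift p.
set s1 := \sum_b _; set s2 := \sum_b _; set s3 := \sum_b _.
set w := enorm (weighted_mean_curvature F u); set rho := enorm _.
(* Half the Hessian inequality and half the gradient identity, then the trace bound [t] and
   Cauchy-Schwarz [c]. *)
move=> g h t c; nra.
Qed.
End Gram.

(** * Limits of matrices, and continuity of the barrier form *)

Lemma cvg_sum_fin (R : realType) (T : Type) (D : set_system T) (FD : Filter D)
    (I : Type) (s : seq I) (f : I -> T -> R) (l : I -> R) :
  (forall i, f i v @[v --> D] --> l i) ->
  \sum_(i <- s) f i v @[v --> D] --> \sum_(i <- s) l i.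
Proof. by move=> H; apply: cvg_big => // x; exact: add_continuous. Qed.

Lemma cvg_prod_fin (R : realType) (T : Type) (D : set_system T) (FD : Filter D)
    (I : Type) (s : seq I) (f : I -> T -> R) (l : I -> R) :
  (forall i, f i v @[v --> D] --> l i) ->
  \prod_(i <- s) f i v @[v --> D] --> \prod_(i <- s) l i.
Proof. by move=> H; apply: cvg_big => // x; exact: mul_continuous. Qed.

Section MxCvg.
Context (R : realType) (T : Type) (D : set_system T) {FD : ProperFilter D}.

(** Entrywise, so that products, determinants and inverses reduce to finite sums and products of
    real limits. *)
Definition mxcvg (p q : nat) (A : T -> 'M[R]_(p, q)) (L : 'M[R]_(p, q)) :=
  forall i j, A v i j @[v --> D] --> L i j.

Lemma mxcvg_add (p q : nat) (A B : T -> 'M[R]_(p, q)) (L K : 'M[R]_(p, q)) :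
  mxcvg A L -> mxcvg B K -> mxcvg (fun v => A v + B v) (L + K).
Proof.
move=> HA HB i j; rewrite mxE.
under eq_cvg do rewrite mxE.
exact: cvgD.
Qed.

Lemma mxcvg_opp (p q : nat) (A : T -> 'M[R]_(p, q)) (L : 'M[R]_(p, q)) :
  mxcvg A L -> mxcvg (fun v => - A v) (- L).
Proof.
move=> HA i j; rewrite mxE.
under eq_cvg do rewrite mxE.
exact: cvgN.
Qed.

Lemma mxcvg_cst (p q : nat) (L : 'M[R]_(p, q)) : mxcvg (fun=> L) L.
Proof. by move=> i j; exact: cvg_cst. Qed.

Lemma mxcvg_tr (p q : nat) (A : T -> 'M[R]_(p, q)) (L : 'M[R]_(p, q)) :
  mxcvg A L -> mxcvg (fun v => (A v)^T) L^T.
Proof.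
move=> HA i j; rewrite mxE.
under eq_cvg do rewrite mxE.
exact: HA.
Qed.

Lemma mxcvg_mul (p q s : nat) (A : T -> 'M[R]_(p, q)) (B : T -> 'M[R]_(q, s)) L K :
  mxcvg A L -> mxcvg B K -> mxcvg (fun v => A v *m B v) (L *m K).
Proof.
move=> HA HB i j; rewrite mxE.
under eq_cvg do rewrite mxE.
by apply: cvg_sum_fin => l; apply: cvgM.
Qed.

Lemma mxcvg_sum (p q : nat) (I : finType) (A : I -> T -> 'M[R]_(p, q))
    (L : I -> 'M[R]_(p, q)) :
  (forall k, mxcvg (A k) (L k)) ->
  mxcvg (fun v => \sum_k A k v) (\sum_k L k).
Proof.
move=> HA i j; rewrite summxE.
under eq_cvg do rewrite summxE.
by apply: cvg_sum_fin => k; exact: HA.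
Qed.

Lemma mxcvg_scale (p q : nat) (a : T -> R) (A : T -> 'M[R]_(p, q)) (c : R) L :
  a v @[v --> D] --> c -> mxcvg A L -> mxcvg (fun v => a v *: A v) (c *: L).
Proof.
move=> Ha HA i j; rewrite mxE.
under eq_cvg do rewrite mxE.
exact: cvgM.
Qed.

Lemma mxcvg_det (p : nat) (A : T -> 'M[R]_p) (L : 'M[R]_p) :
  mxcvg A L -> \det (A v) @[v --> D] --> \det L.
Proof.
move=> HA; apply: cvg_sum_fin => s; apply: cvgM; first exact: cvg_cst.
by apply: cvg_prod_fin.
Qed.

Lemma mxcvg_trace (p : nat) (A : T -> 'M[R]_p) (L : 'M[R]_p) :
  mxcvg A L -> \tr (A v) @[v --> D] --> \tr L.
Proof. by move=> HA; apply: cvg_sum_fin. Qed.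

Lemma mxcvg_inv (p : nat) (A : T -> 'M[R]_p) (L : 'M[R]_p) :
  L \in unitmx -> mxcvg A L -> mxcvg (fun v => invmx (A v)) (invmx L).
Proof.
move=> Lu HA i j.
have dL : \det L != 0 by rewrite -unitfE.
have dA := mxcvg_det HA.
(* [invmx] returns a singular matrix unchanged, so the adjugate formula holds for [A v] only once
   its determinant is nonzero, which is eventually the case. *)
have nz : \forall v \near D, \det (A v) != 0. exact: cvgr_neq0 dA dL.
rewrite /invmx Lu mxE.
have : (\det (A v))^-1 * (\adj (A v)) i j @[v --> D] --> (\det L)^-1 * (\adj L) i j.
  apply: cvgM; first exact: cvgV.
  rewrite mxE; under eq_cvg do rewrite mxE.
  apply: cvgM; first exact: cvg_cst.
  apply: mxcvg_det => k l; rewrite !mxE.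
  under eq_cvg do rewrite !mxE.
  exact: HA.
apply: cvg_trans; apply: near_eq_cvg; near=> v.
have -> : A v \in unitmx by rewrite unitmxE unitfE; near: v.
by rewrite [RHS]mxE.
Unshelve. all: by end_near. Qed.

Lemma cvg_const_mul (c : R) (a : T -> R) (l : R) :
  a v @[v --> D] --> l -> c * a v @[v --> D] --> c * l.
Proof. by move=> al; apply: cvgM => //; exact: cvg_cst. Qed.

Lemma cvg_sub3 (a b c : T -> R) (k l s : R) :
  a v @[v --> D] --> k -> b v @[v --> D] --> l -> c v @[v --> D] --> s ->
  a v - b v - c v @[v --> D] --> k - l - s.
Proof. by move=> ak bl cs; apply: cvgB => //; exact: cvgB. Qed.

Lemma cvg_dotv (n : nat) (a b : T -> 'rV[R]_n) (k l : 'rV[R]_n) :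
  mxcvg a k -> mxcvg b l -> dotv (a v) (b v) @[v --> D] --> dotv k l.
Proof. by move=> ak bl; apply: cvg_sum_fin => i; apply: cvgM. Qed.
End MxCvg.

(** The form is built from the partial derivatives of [F] of order at most two and the inverse Gram
    matrix, all continuous at [z]. Its positivity at [z] therefore persists nearby. *)
Lemma barrier_form_cvg (R : realType) (n m : nat) (F : 'rV[R]_n -> 'rV[R]_m)
    (U : set 'rV[R]_n) (al : R) (y z : 'rV[R]_n) :
  open U -> Ck_on 2 U F -> U z -> injective ('d F z) ->
  barrier_form F v al y @[v --> z] --> barrier_form F z al y.
Proof.
move=> Uo [cF [dF dF1]] Uz inj.
have coord (f : 'rV[R]_n -> 'rV[R]_m) : {for z, continuous f} -> mxcvg (nbhs z) f (f z).
  move=> cf i j.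
  apply: (@cvg_comp _ _ _ f (fun A : 'rV[R]_m => A i j) _ (nbhs (f z)) _ cf).
  exact: coord_continuous.
(* The Jacobian entries are coordinates of partial derivatives wherever [F] is differentiable, thus
   on the neighbourhood [U] of [z]. *)
have cJ : mxcvg (nbhs z) (fun v => 'J F v) ('J F z).
  move=> i a.
  have JE v : U v -> 'J F v i a = partial i F v 0 a.
    move=> Uv; rewrite /partial /basis_vec deriveEjacobian -?rowE; [by rewrite [RHS]mxE | exact: dF].
  rewrite [X in _ --> X](JE z Uz).
  have [cp _] := dF1 i.
  have := coord _ (cp z Uz) 0 a.
  apply: cvg_trans; apply: near_eq_cvg; near=> v; rewrite [RHS](JE v); first by [].
  by near: v; apply: open_nbhs_nbhs.
have cG : mxcvg (nbhs z) (fun v => invmx (gram F v)) (invmx (gram F z)).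
  by apply: mxcvg_inv; [exact: gram_unit|apply: mxcvg_mul => //; exact: mxcvg_tr].
have cid : mxcvg (nbhs z) (fun v => v - y) (z - y).
  apply: mxcvg_add; last exact: mxcvg_cst.
  by move=> i j; exact: coord_continuous.
have cS : mxcvg (nbhs z) (raw_laplacian F) (raw_laplacian F z).
  apply: mxcvg_sum => k; apply: mxcvg_sum => l; apply: mxcvg_scale; first exact: cG.
  apply: (coord (partial k (partial l F))).
  by have [_ [_ h]] := dF1 l; have [h' _] := h k; exact: h'.
have cb : mxcvg (nbhs z) (drift F) (drift F z).
  apply: mxcvg_mul => //; apply: mxcvg_mul; last exact: mxcvg_tr.
  by apply: mxcvg_opp; apply: mxcvg_add => //; apply: (coord F); exact: cF.
have h1 : 2 * al * ((v - y) *m invmx (gram F v) *m (v - y)^T) 0 0 @[v --> z] -->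
    2 * al * ((z - y) *m invmx (gram F z) *m (z - y)^T) 0 0.
  have H : mxcvg (nbhs z) (fun v => (v - y) *m invmx (gram F v) *m (v - y)^T)
    ((z - y) *m invmx (gram F z) *m (z - y)^T).
    by apply: mxcvg_mul; [apply: mxcvg_mul|exact: mxcvg_tr].
  exact: (cvg_const_mul (H 0 0)).
have h2 : \tr (invmx (gram F v)) @[v --> z] --> \tr (invmx (gram F z)).
  exact: (mxcvg_trace cG).
have h3 : dotv (drift F v) (v - y) @[v --> z] --> dotv (drift F z) (z - y).
  exact: (cvg_dotv cb cid).
exact: (cvg_sub3 h1 h2 h3).
Unshelve. all: by end_near. Qed.

(** * Euclidean balls: continuity, compactness and a touching ball *)

Lemma continuous_dotv (R : realType) (T : topologicalType) (n : nat)
    (f g : T -> 'rV[R]_n) (x : T) :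
  {for x, continuous f} -> {for x, continuous g} ->
  {for x, continuous (fun v => dotv (f v) (g v))}.
Proof.
move=> cf cg; apply: cvg_sum_fin => i; apply: cvgM.
  apply: (@cvg_comp _ _ _ f (fun A : 'rV[R]_n => A 0 i) _ (nbhs (f x)) _ cf).
  exact: coord_continuous.
apply: (@cvg_comp _ _ _ g (fun A : 'rV[R]_n => A 0 i) _ (nbhs (g x)) _ cg).
exact: coord_continuous.
Qed.

Lemma continuous_sqdist (R : realType) (n : nat) (y : 'rV[R]_n) :
  continuous (fun v : 'rV[R]_n => dotv (v - y) (v - y)).
Proof.
move=> v; have H : {for v, continuous (fun w : 'rV[R]_n => w - y)}.
  apply: (@continuousB _ _ _ id (cst y)); first exact: cvg_id.
  exact: (@cst_continuous _ _ y v).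
exact: (continuous_dotv H H).
Qed.

Lemma le_norm_enorm (R : realType) (n : nat) (x : 'rV[R]_n) :
  `|x| <= enorm x.
Proof.
rewrite [leLHS]/Num.Def.normr /= mx_normrE; apply: bigmax_le; first exact: sqrtr_ge0.
move=> [i j] _ /=; rewrite -sqrtr_sqr ler_wsqrtr // ord1 /dotv (bigD1 j) //=.
rewrite -expr2 lerDl.
by apply: sumr_ge0 => k _; rewrite -expr2 sqr_ge0.
Qed.

Lemma norm_lt_of_sqdist (R : realType) (n : nat) (x : 'rV[R]_n) (e : R) :
  0 < e -> dotv x x < e ^+ 2 -> `|x| < e.
Proof.
move=> e0 xe; apply: le_lt_trans (le_norm_enorm x) _.
by rewrite -[e]gtr0_norm // -sqrtr_sqr ltr_sqrt // exprn_gt0.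
Qed.

Lemma closed_sqdist_le (R : realType) (n : nat) (y : 'rV[R]_n) (c : R) :
  closed [set x : 'rV[R]_n | dotv (x - y) (x - y) <= c].
Proof.
apply: (@closed_comp _ _ (fun x : 'rV[R]_n => dotv (x - y) (x - y)) [set t | t <= c]).
  by move=> x _; exact: continuous_sqdist.
exact: closed_le.
Qed.

Lemma bounded_norm_sub (R : realType) (n : nat) (y : 'rV[R]_n) (c : R)
    (A : set 'rV[R]_n) :
  (forall x, A x -> `|x - y| <= c) -> bounded_set A.
Proof.
move=> Ac; exists (`|y| + c); split; first exact: num_real.
move=> t ct x /Ac xy; apply: le_trans (ltW ct).
have -> : x = y + (x - y) by rewrite addrC subrK.
by apply: le_trans (ler_normD _ _) _; rewrite lerD2l.
Qed.

Lemma compact_sqdist_le (R : realType) (n : nat) (y : 'rV[R]_n) (c : R) :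
  compact [set x : 'rV[R]_n | dotv (x - y) (x - y) <= c].
Proof.
apply: bounded_closed_compact; last exact: closed_sqdist_le.
apply: (@bounded_norm_sub _ _ y (Num.sqrt c)) => x /= xc.
by apply: le_trans (le_norm_enorm _) _; rewrite ler_wsqrtr.
Qed.

(** [W] is continuous only at the points of [K]. A limit point of the level set lies in the closed
    set [K], and there [W x != c] would persist on a neighbourhood. *)
Lemma compact_level (R : realType) (n : nat) (K : set 'rV[R]_n)
    (W : 'rV[R]_n -> R) (c : R) :
  compact K -> (forall x, K x -> {for x, continuous W}) ->
  compact (K `&` [set x | W x = c]).
Proof.
move=> cK cW.
have clK : closed K by apply: compact_closed.
apply: (subclosed_compact _ cK); last by move=> x [].
move=> x clx; have Kx : K x by apply: clK => B /clx [t [[Kt _] Bt]]; exists t.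
split => //=; apply/eqP; apply: contrapT => /negP Wx.
have nW : \forall v \near x, W v - c != 0.
  have : W v - c @[v --> x] --> W x - c.
    apply: (@continuousB _ _ _ W (cst c)); first exact: cW.
    exact: (@cst_continuous _ _ c x).
  by move=> /cvgr_neq0; apply; rewrite subr_eq0.
by have [t [[_ /= Wt]]] := clx _ nW; rewrite Wt subrr eqxx.
Qed.

(* z is a zero nearest to a point y1 with W y1 > 0, and y is the midpoint of y1
   and z: halving the ball makes z the only point of contact. *)
Lemma touching_ball (R : realType) (n : nat) (U : set 'rV[R]_n)
    (W : 'rV[R]_n -> R) (u0 : 'rV[R]_n) :
  open U -> U u0 -> (forall v, U v -> {for v, continuous W}) ->
  (forall v, U v -> 0 <= W v) -> W u0 = 0 ->
  ~ (\forall v \near u0, W v = 0) ->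
  exists y z : 'rV[R]_n, [/\ z != y, U z, W z = 0 &
    forall x, dotv (x - y) (x - y) <= dotv (z - y) (z - y) -> x != z ->
      U x /\ 0 < W x].
Proof.
move=> Uo Uu0 cW W0 Wu0 nW.
have [e /= e0 eU] : nbhs_ball u0 U by rewrite nbhs_ballE; apply: open_nbhs_nbhs.
(* Within half the radius [e], so that the closed ball about [y1] through [u0] stays in [U]. *)
have [y1 y1u Wy1] : exists2 y1, dotv (y1 - u0) (y1 - u0) < (e / 2) ^+ 2 & W y1 != 0.
  apply: contrapT => H; apply: nW.
  have : \forall v \near u0, dotv (v - u0) (v - u0) < (e / 2) ^+ 2.
    have := @continuous_sqdist _ _ u0 u0.
    move/cvgr_lt; apply; rewrite subrr /dotv big1; last by move=> i _; rewrite mxE mul0r.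
    by rewrite exprn_gt0 // divr_gt0.
  apply: filterS => v ve; apply: contrapT => /eqP Wv; apply: H; by exists v.
(* The parallelogram law. It serves both to keep that ball in [U] and to obtain the strict
   inequality below. *)
have sq4 (a b : 'rV[R]_n) : dotv (a + b) (a + b) =
    2 * dotv a a + 2 * dotv b b - dotv (a - b) (a - b).
  rewrite /dotv !mulr_sumr -big_split -sumrB /=; apply: eq_bigr => i _.
  by rewrite !mxE; ring.
have sqN (a : 'rV[R]_n) : dotv (- a) (- a) = dotv a a.
  by apply: eq_bigr => i _; rewrite !mxE mulrNN.
have DU x : dotv (x - y1) (x - y1) <= dotv (u0 - y1) (u0 - y1) -> U x.
  move=> xD; apply: eU; rewrite -ball_normE /= distrC.
  apply: norm_lt_of_sqdist => //.
  rewrite -(subrKA y1) sq4.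
  have := dotv_ge0 (x - y1 - (y1 - u0)).
  move: xD; rewrite -(opprB y1 u0) sqN.
  move: y1u; rewrite exprMn exprVn; lra.
pose K := [set x : 'rV[R]_n | dotv (x - y1) (x - y1) <= dotv (u0 - y1) (u0 - y1)].
have cK : compact (K `&` [set x | W x = 0]).
  by apply: compact_level; [exact: compact_sqdist_le | move=> x /DU /cW].
have K0 : K `&` [set x | W x = 0] !=set0 by exists u0; split; first exact: lexx.
have [z] := compact_EVT_min K0 cK (continuous_subspaceT (@continuous_sqdist _ _ y1)).
rewrite inE => -[Kz /= Wz] zmin.
pose y := 2^-1 *: (y1 + z).
have yE : y - y1 = z - y.
  by apply/rowP => i; rewrite !mxE; field.
have zy1 : z != y1 by apply: contraNneq Wy1 => <-; rewrite Wz.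
have qz : z - y1 = (z - y) + (z - y) by rewrite -{2}yE subrKA.
have zy : z != y.
  apply: contraNneq zy1 => e1; rewrite -subr_eq0 qz e1 subrr addr0 //.
exists y, z; split => //; first exact: DU.
move=> x xy xz.
(* As [y] is the midpoint of [y1] and [z], |x - y1|^2 = 2 |x - y|^2 + 2 |z - y|^2 - |x - z|^2 < 4 |z
   - y|^2 = |z - y1|^2. So [x] is nearer to [y1] than the nearest zero. *)
have lt : dotv (x - y1) (x - y1) < dotv (z - y1) (z - y1).
  have -> : x - y1 = (x - y) + (y - y1) by rewrite subrKA.
  rewrite qz yE (sq4 (x - y) (z - y)) (sq4 (z - y) (z - y)) subrr.
  have -> : x - y - (z - y) = x - z by rewrite opprB addrA subrK.
  have : 0 < dotv (x - z) (x - z) by rewrite lt_def dotv_ge0 dotv_eq0 subr_eq0 xz.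
  have -> : dotv (0 : 'rV[R]_n) 0 = 0 by apply/eqP; rewrite dotv_eq0.
  lra.
have Kx : K x by rewrite /K /= (le_trans (ltW lt)).
split; first exact: DU.
rewrite lt_def W0 ?andbT; last exact: DU.
apply/eqP => Wx; have := zmin x; rewrite inE => /(_ (conj Kx Wx)).
by rewrite leNgt lt.
Qed.

(** * The strong minimum principle *)

Lemma penalizedE (R : realType) (n m : nat) (F : 'rV[R]_n -> 'rV[R]_m)
    (d : pred 'I_m) (eps al : R) (y v : 'rV[R]_n) :
  penalized F (fun a => (d a)%:R) eps al y v =
  enorm (masked d (F v)) ^+ 2 - eps * expR (- al * dotv (v - y) (v - y)).
Proof.
congr (_ - _); rewrite sqr_enorm; apply: eq_bigr => a _; rewrite !mxE.
by case: (d a); rewrite ?mul1r ?mul0r // expr2.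
Qed.

Lemma continuous_mask_sqr (R : realType) (T : topologicalType) (m : nat)
    (F : T -> 'rV[R]_m) (d : pred 'I_m) (x : T) :
  {for x, continuous F} -> {for x, continuous (fun v => enorm (masked d (F v)) ^+ 2)}.
Proof.
move=> cF.
have -> : (fun v => enorm (masked d (F v)) ^+ 2) =
    (fun v => \sum_a (d a)%:R * (F v 0 a) ^+ 2).
  apply/funext => v; rewrite sqr_enorm; apply: eq_bigr => a _; rewrite !mxE.
  by case: (d a); rewrite ?mul1r ?mul0r // expr2.
apply: cvg_sum_fin => a; apply: cvg_const_mul; apply: cvgM;
  (apply: (@cvg_comp _ _ _ F (fun A : 'rV[R]_m => A 0 a) _ (nbhs (F x)) _ cF);
  exact: coord_continuous).
Qed.

Lemma continuous_gauss (R : realType) (n : nat) (al : R) (y : 'rV[R]_n) :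
  continuous (fun v : 'rV[R]_n => expR (- al * dotv (v - y) (v - y))).
Proof.
move=> v.
have H : {for v, continuous (fun v : 'rV[R]_n => - al * dotv (v - y) (v - y))}.
  exact: (cvg_const_mul (@continuous_sqdist _ _ y v)).
apply: (@continuous_comp _ _ _ _ expR _ H); exact: continuous_expR.
Qed.

(** Otherwise a ball touches the zero set of |Y|^2 - r^2 at a single point [z]. Subtracting a small
    multiple of a barrier with positive L near [z] produces an interior minimum near [z], where
    [penalized_min_le] contradicts the sign given by [rho_le]. *)
Lemma strong_minimum (R : realType) (n m : nat) (F : 'rV[R]_n -> 'rV[R]_m)
    (U : set 'rV[R]_n) (d : pred 'I_m) (lambda r : R) (u0 : 'rV[R]_n) :
  open U -> Ck_on 2 U F -> (forall u, U u -> injective ('d F u)) ->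
  (forall u, U u -> enorm (weighted_mean_curvature F u) = lambda) ->
  (forall rho, r <= rho -> n%:R + lambda * rho - rho ^+ 2 <= 0) -> 0 <= r ->
  (forall u, U u -> r <= enorm (masked d (F u))) ->
  U u0 -> enorm (masked d (F u0)) = r ->
  \forall v \near u0, enorm (masked d (F v)) = r.
Proof.
move=> Uo CF inj lam rho_le r0 rle Uu0 Fu0.
have [cF _] := CF.
pose w v := enorm (masked d (F v)) ^+ 2.
pose W v := w v - r ^+ 2.
have cw v : U v -> {for v, continuous w}.
  by move=> Uv; apply: continuous_mask_sqr; exact: cF.
have cW v : U v -> {for v, continuous W}.
  move=> Uv; apply: (@continuousB _ _ _ w (cst (r ^+ 2))); first exact: cw.
  exact: (@cst_continuous _ _ (r ^+ 2) v).
have W0 v : U v -> 0 <= W v.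
  by move=> Uv; rewrite /W subr_ge0 lerXn2r ?nnegrE ?sqrtr_ge0 // rle.
have WE v : W v = 0 -> enorm (masked d (F v)) = r.
  move=> /eqP; rewrite subr_eq0 eqrXn2 ?sqrtr_ge0 // => /eqP //.
apply: contrapT => nW.
have Wu0 : W u0 = 0 by rewrite /W /w Fu0 subrr.
have nW' : ~ (\forall v \near u0, W v = 0).
  by move=> H; apply: nW; apply: filterS H => v /WE.
have [y [z [zy Uz Wz ball]]] := touching_ball Uo Uu0 cW W0 Wu0 nW'.
pose q := ((z - y) *m invmx (gram F z) *m (z - y)^T) 0 0.
have q0 : 0 < q by apply: gram_inv_gt0; [exact: inj | rewrite subr_eq0].
pose t := \tr (invmx (gram F z)) + dotv (drift F z) (z - y).
(* Chosen so that [2 * al * q] is |t| + 1, which makes the barrier form at [z] at least 1. *)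
pose al : R := (`|t| + 1) / (2 * q).
have al0 : 0 < al by rewrite divr_gt0 ?mulr_gt0 // ltr_wpDl.
have bz : 0 < barrier_form F z al y.
  have e2 : 2 * al * q = `|t| + 1 by rewrite /al; field; rewrite gt_eqF.
  rewrite /barrier_form -/q e2 -addrA -opprD -/t.
  by have := ler_norm t; lra.
have [dl /= dl0 dlP] : exists2 dl : R, 0 < dl & forall v, `|v - z| <= dl ->
    U v /\ 0 < barrier_form F v al y.
  have : \forall v \near z, U v /\ 0 < barrier_form F v al y.
    have H1 : \forall v \near z, U v by apply: open_nbhs_nbhs.
    have H2 : \forall v \near z, 0 < barrier_form F v al y.
      have H3 := @barrier_form_cvg _ _ _ F U al y z Uo CF Uz (inj _ Uz).
      by move/cvgr_gt: H3; apply.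
    by near do split.
  move=> /nbhs_ballP[e /= e0 He]; exists (e / 2); first by rewrite divr_gt0.
  move=> v ve; apply: He; rewrite -ball_normE /= distrC.
  by apply: le_lt_trans ve _; rewrite ltr_pdivrMr // ltr_pMr // ltr1n.
(* A ball of the sup norm, that is, a cube about [z]. *)
pose C := [set v : 'rV[R]_n | `|v - z| <= dl].
have cnorm : continuous (fun v : 'rV[R]_n => `|v - z|).
  move=> v; have H : {for v, continuous (fun v : 'rV[R]_n => v - z)}.
    apply: (@continuousB _ _ _ id (cst z)); first exact: cvg_id.
    exact: (@cst_continuous _ _ z v).
  apply: (@continuous_comp _ _ _ (fun v : 'rV[R]_n => v - z)
    (fun x : 'rV[R]_n => `|x|) _ H).
  exact: norm_continuous.
have cC : compact C.
  apply: bounded_closed_compact; first exact: (@bounded_norm_sub _ _ z dl).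
  apply: (@closed_comp _ _ (fun v : 'rV[R]_n => `|v - z|) [set t | t <= dl]).
    by move=> x _; exact: cnorm.
  exact: closed_le.
(* The part of the boundary of [C] in the closed touching ball. It avoids [z], so [W] is positive on
   it and, by compactness, bounded below by some [mu > 0]. *)
pose S := (C `&` [set v | `|v - z| = dl]) `&`
  [set v | dotv (v - y) (v - y) <= dotv (z - y) (z - y)].
have cS : compact S.
  apply: compact_closedI; last exact: closed_sqdist_le.
  by apply: compact_level => // x _; exact: cnorm.
have Spos x : S x -> 0 < W x.
  move=> [[_ /= xz] xy]; apply: (ball _ xy _).2; apply: contra_eqN xz => /eqP ->.
  by rewrite subrr normr0 eq_sym gt_eqF.
have [mu mu0 muP] : exists2 mu, 0 < mu & forall x, S x -> mu <= W x.
  have [S0|/set0P/negP/negPn/eqP S0] := pselect (S !=set0); last first.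
    by exists 1 => // x; rewrite S0.
  have cWS : {within S, continuous W}.
    apply: continuous_in_subspaceT => x; rewrite inE => -[[Cx _] _].
    by apply: cW; have [] := dlP x Cx.
  have [c + cmin] := compact_EVT_min S0 cS cWS.
  rewrite inE => Sc; exists (W c); first exact: Spos.
  by move=> x Sx; apply: cmin; rewrite inE.
pose eps := mu / 2.
have eps0 : 0 < eps by rewrite divr_gt0.
pose P := penalized F (fun a => (d a)%:R) eps al y.
have PE v : P v = W v + r ^+ 2 - eps * expR (- al * dotv (v - y) (v - y)).
  by rewrite /P penalizedE /W subrK.
(* On [S], [W] is at least [2 * eps] and the barrier at most 1. On the rest of the boundary [W] is
   nonnegative and the barrier is smaller than at [z]. *)
have Pbd x : `|x - z| = dl -> P z < P x.
  move=> xz; rewrite !PE Wz add0r.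
  have Cx : C x by rewrite /C /= xz.
  have [Ux _] := dlP x Cx.
  have [xy|xy] := leP (dotv (x - y) (x - y)) (dotv (z - y) (z - y)).
    have mux : mu <= W x by apply: muP; do !split.
    have ex1 : expR (- al * dotv (x - y) (x - y)) <= 1.
      by rewrite expR_le1 mulNr oppr_le0 mulr_ge0 ?dotv_ge0 // ltW.
    have ez0 := expR_gt0 (- al * dotv (z - y) (z - y)).
    have e2 : mu = 2 * eps by rewrite /eps; field.
    rewrite {}e2 in mux.
    have := ler_wpM2l (ltW eps0) ex1; have := mulr_gt0 eps0 ez0; lra.
  have := W0 x Ux.
  have : expR (- al * dotv (x - y) (x - y)) < expR (- al * dotv (z - y) (z - y)).
    by rewrite ltr_expR !mulNr ltrN2 ltr_pM2l.
  rewrite -(ltr_pM2l eps0); lra.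
have cP : {within C, continuous P}.
  apply: continuous_in_subspaceT => x; rewrite inE => Cx.
  have [Ux _] := dlP x Cx.
  have -> : P = (fun v => w v - eps * expR (- al * dotv (v - y) (v - y))).
    by apply/funext => v; rewrite /P penalizedE.
  apply: (@continuousB _ _ _ w (fun v => eps * expR (- al * dotv (v - y) (v - y)))).
    exact: cw.
  exact: (cvg_const_mul (@continuous_gauss _ _ al y x)).
have Cz : C z by rewrite /C /= subrr normr0 ltW.
have C0 : C !=set0 by exists z.
have [c] := compact_EVT_min C0 cC cP.
rewrite inE => Cc cmin.
(* The minimum over [C] is not on the boundary, since [P z] is smaller there; hence it is a local
   minimum. *)
have cz : `|c - z| < dl.
  rewrite lt_neqAle Cc andbT; apply/negP => /eqP /Pbd.
  by rewrite ltNge cmin ?inE.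
have [Uc bc] := dlP c Cc.
have nearc : \forall v \near c, P c <= P v.
  have : \forall v \near c, `|v - z| < dl by move/cvgr_lt: (cnorm c); apply.
  by apply: filterS => v /ltW vC; apply: cmin; rewrite inE.
have := penalized_min_le (inj c Uc) Uo CF Uc nearc.
rewrite leNgt => /negP; apply.
rewrite lam //; apply: le_lt_trans (rho_le _ (rle c Uc)) _.
by apply: mulr_gt0 => //; apply: mulr_gt0; [exact: mulr_gt0 | exact: expR_gt0].
Unshelve. all: by end_near. Qed.

Lemma enorm_split_coords (R : realType) (d m : nat) (hdm : (d <= m)%N)
    (x : 'rV[R]_m) :
  enorm (split_coords hdm x).1 = enorm (masked (fun a => (a < d)%N) x).
Proof.
rewrite /enorm /split_coords /=; congr Num.sqrt; rewrite dotv_mask.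
(* Generalizing [m - d] turns the cast into one along an equation that can be eliminated. *)
move: (subnKC hdm); move: (m - d)%N => s e.
case: m / e {hdm} x => x.
rewrite castmx_id /dotv big_split_ord /= [X in _ = _ + X]big1 ?addr0.
  by apply: eq_bigr => i _; rewrite !mxE /= ltn_ord mul1r.
by move=> i _; rewrite mxE /= ltnNge leq_addr /= !mul0r.
Qed.

Lemma masked_predT (R : realType) (m : nat) (x : 'rV[R]_m) : masked predT x = x.
Proof. by apply/rowP => a; rewrite mxE mul1r. Qed.

Lemma le_enorm_masked (R : realType) (m : nat) (d : pred 'I_m) (x : 'rV[R]_m) :
  enorm (masked d x) <= enorm x.
Proof.
rewrite ler_wsqrtr // dotv_mask; apply: ler_sum => a _; rewrite mxE.
by case: (d a); rewrite ?mul1r // !mul0r -expr2 sqr_ge0.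
Qed.

(** * The radius as a root of the quadratic *)

Section Radius.
Context (R : realType) (n : nat) (lambda r : R).
Hypotheses (hlambda : 0 <= lambda)
  (hr : r = (lambda + Num.sqrt (lambda ^+ 2 + 4 * n%:R)) / 2).

Let s := Num.sqrt (lambda ^+ 2 + 4 * n%:R).

Let ss : s ^+ 2 = lambda ^+ 2 + 4 * n%:R.
Proof. by rewrite sqr_sqrtr // addr_ge0 ?sqr_ge0 ?mulr_ge0. Qed.

(** The second root [(lambda - s) / 2] is thus nonpositive, and the sign of the quadratic on
    [rho >= r] is decided by the factor [rho - r]. *)
Let ls : lambda <= s.
Proof.
rewrite -[leLHS]ger0_norm // -sqrtr_sqr ler_wsqrtr // lerDl mulr_ge0 //.
Qed.

Lemma radius_ge0 : 0 <= r.
Proof. by rewrite hr divr_ge0 // addr_ge0 // sqrtr_ge0. Qed.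

Lemma radius_factor (rho : R) :
  n%:R + lambda * rho - rho ^+ 2 = - ((rho - r) * (rho - (lambda - s) / 2)).
Proof.
have -> : n%:R = (s ^+ 2 - lambda ^+ 2) / 4 :> R by rewrite ss; field.
by rewrite hr -/s; field.
Qed.

Lemma radius_le (rho : R) : r <= rho -> n%:R + lambda * rho - rho ^+ 2 <= 0.
Proof.
move=> h; rewrite radius_factor oppr_le0 mulr_ge0 ?subr_ge0 //.
have := radius_ge0; have := ls; lra.
Qed.

Lemma radius_lt (rho : R) : r < rho -> n%:R + lambda * rho - rho ^+ 2 < 0.
Proof.
move=> h; rewrite radius_factor oppr_lt0 mulr_gt0 ?subr_gt0 //.
have := radius_ge0; have := ls; lra.
Qed.
End Radius.

(** * From charts to the whole submanifold *)

Section Submanifold.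
Context (R : realType) (n m : nat) (M : topologicalType)
  (A : set (chart R n M)) (X : M -> 'rV[R]_m) (lambda r : R) (d : pred 'I_m).
Hypotheses (hA : smooth_atlas A) (himm : immersion A X) (hproper : proper_map X)
  (hX : lambda_submanifold A X lambda) (r0 : 0 <= r)
  (rho_le : forall rho, r <= rho -> n%:R + lambda * rho - rho ^+ 2 <= 0)
  (rho_lt : forall rho, r < rho -> n%:R + lambda * rho - rho ^+ 2 < 0)
  (rle : forall x, r <= enorm (masked d (X x))).

Lemma curvature_cimg (c : chart R n M) (u : 'rV[R]_n) : A c -> cimg c u ->
  enorm (weighted_mean_curvature (X \o cinv c) u) = lambda.
Proof. by move=> Ac [x cx <-]; exact: hX. Qed.

(** [strong_minimum] in a chart about a contact point, pulled back by continuity of the chart. *)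
Lemma open_contact : open [set x | enorm (masked d (X x)) = r].
Proof.
have [hch hcov _] := hA.
rewrite openE => x0 /= Zx0; rewrite /interior.
have [c Ac cx0] := hcov x0.
have [cdo cio cK cmc cic] := hch c Ac.
have [sF iF] := himm Ac.
have Uu0 : cimg c (cmap c x0) by exists x0.
have H := @strong_minimum _ _ _ (X \o cinv c) (cimg c) d lambda r (cmap c x0)
  cio (sF 2%N) iF (fun u => curvature_cimg Ac) rho_le r0 (fun u _ => rle _) Uu0.
have /H {}H : enorm (masked d ((X \o cinv c) (cmap c x0))) = r by rewrite /= cK.
have H1 : \forall x \near x0, enorm (masked d (X (cinv c (cmap c x)))) = r.
  exact: (cmc x0 cx0 _ H).
have H2 : \forall x \near x0, cdom c x by apply: open_nbhs_nbhs.
by near=> x; rewrite /= -(cK x); [near: x | near: x].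
Unshelve. all: by end_near. Qed.

Lemma contact_everywhere (x : M) : enorm (masked d (X x)) = r.
Proof.
have [hch hcov _] := hA; have [cX pX] := hproper.
apply: contrapT => /eqP Zx.
pose V := [set x | r < enorm (masked d (X x))].
have VE : V = ~` [set x | enorm (masked d (X x)) = r].
  apply/seteqP; rewrite /V; split => t /=; first by move=> rt e; rewrite e ltxx in rt.
  by move=> /eqP rt; rewrite lt_neqAle rle andbT eq_sym.
(* Closedness of [V] makes the set on which |X|^2 is minimized compact; openness of [V] makes that
   minimum a local one in [M]. *)
have clV : closed V by rewrite VE; apply: open_closedC; exact: open_contact.
have opV : open V.
  have -> : V = (fun x => enorm (masked d (X x)) ^+ 2) @^-1` [set t | r ^+ 2 < t].
    by apply/seteqP; rewrite /V; split => t /=; rewrite ltr_sqr ?nnegrE ?sqrtr_ge0.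
  apply: open_comp; last exact: open_gt.
  by move=> t _; apply: continuous_mask_sqr; exact: cX.
have Vx : V x by rewrite /V /= lt_neqAle rle andbT eq_sym.
pose B := [set v : 'rV[R]_m | dotv (v - 0) (v - 0) <= dotv (X x) (X x)].
pose f y := dotv (X y) (X y).
have cf : continuous f by move=> y; apply: continuous_dotv; exact: cX.
have cKV : compact (X @^-1` B `&` V).
  by apply: compact_closedI => //; apply: pX; exact: compact_sqdist_le.
have KV0 : X @^-1` B `&` V !=set0 by exists x; split => //; rewrite /B /= subr0.
have [xm] := compact_EVT_min KV0 cKV (continuous_subspaceT cf).
rewrite inE => -[Bxm Vxm] fmin.
(* Outside the preimage of [B], |X| exceeds its value at [x], which is at least the minimum. *)
have fminV y : V y -> f xm <= f y.
  move=> Vy; have [By|By] := leP (dotv (X y - 0) (X y - 0)) (dotv (X x) (X x)).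
    by apply: fmin; rewrite inE.
  rewrite subr0 in By; apply: ltW; apply: le_lt_trans By; move: Bxm.
  by rewrite /B /= !subr0.
have [c Ac cxm] := hcov xm.
have [cdo cio cK cmc cic] := hch c Ac.
have [sF iF] := himm Ac.
pose u := cmap c xm.
have Uu : cimg c u by exists xm.
(* With [eps = 0] and the full mask the penalized function is |X|^2; the values 1 and 0 of [al] and
   [y] are arbitrary. *)
have nearu : \forall v \near u,
    penalized (X \o cinv c) (fun a => (predT a)%:R) 0 1 0 u <=
    penalized (X \o cinv c) (fun a => (predT a)%:R) 0 1 0 v.
  have : \forall v \near u, V (cinv c v).
    apply: (cic u Uu V); rewrite /u cK //; exact: open_nbhs_nbhs.
  apply: filterS => v Vv; rewrite !penalizedE !mul0r !subr0 !masked_predT /=.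
  by rewrite !sqr_enorm /u cK //; exact: fminV.
have := penalized_min_le (iF u Uu) cio (sF 2%N) Uu nearu.
rewrite masked_predT curvature_cimg // !mul0r leNgt => /negP; apply.
(* At [xm], |X| >= |Y| > r. *)
apply: rho_lt; rewrite /= /u cK //.
by apply: lt_le_trans (le_enorm_masked d (X xm)).
Qed.
End Submanifold.

Theorem theorem13 (R : realType) (n p : nat) (hn : (1 <= n)%N) (hp : (1 <= p)%N)
  (lambda : R) (hlambda : 0 <= lambda)
  (M : topologicalType) (A : set (chart R n M)) (X : M -> 'rV[R]_(n + p))
  (hM : smooth_manifold A) (himm : immersion A X)
  (hcomplete : complete_submanifold A X) (hproper : proper_map X)
  (hX : lambda_submanifold A X lambda)
  (k : nat) (hk : (1 <= k <= n + p - 2)%N)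
  (r : R) (hr : r = (lambda + Num.sqrt (lambda ^+ 2 + 4 * n%:R)) / 2)
  (hsub : range X `<=`
     split_coords (leq_split hk) @^-1` (exterior (k:=k) r `*` setT)) :
  range X `<=` split_coords (leq_split hk) @^-1` (esphere (k:=k) r `*` setT).
Proof.
have [_ _ hA] := hM.
(* The condition on the second factor is trivial; the norm of the first component is that of the
   masked vector. *)
move=> _ [x _ <-]; split => //=; rewrite /esphere /= enorm_split_coords.
apply: (contact_everywhere hA himm hproper hX).
- exact: radius_ge0 hlambda hr.
- exact: radius_le hlambda hr.
- exact: radius_lt hlambda hr.
- move=> y; rewrite -(enorm_split_coords (leq_split hk)).
  by have [] := hsub (X y) (ex_intro2 _ _ y I erefl).
Qed.
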